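(* Let $X$ be a set equipped with a representation $\xi:\subseteq\mathcal B\to X$ and with a metric $d$, and let $T:\omega^\omega\times\omega\to\omega$. Suppose $d:X\times X\to\mathbb R$ is computable in time $T$ on $(X,\xi)\times(X,\xi)$. Then there exists a constant $C\in\omega$ such that for every $l\in\omega^\omega$ the function $n\mapsto C\cdot T(l,n+2)^2+C$ is a modulus of total boundedness of the set $\xi(K_l)$ (with respect to $d$).
   Context: $\Sigma=\{0,1\}$, $\Sigma^*$ is the set of finite binary strings, $|a|$ the length of a string; $\omega$ denotes the natural numbers (identified with unary strings $1^n$) and $\mathbb N$ the natural numbers identified with their binary representations; integers are encoded as $\mathbb Z:=\mathbb N\setminus\{\varepsilon\}\cup 0\mathbb N$ where $0n$ means $-n$. The Baire space is $\mathcal B=(\Sigma^* )^{\Sigma^*}$, the set of all total functions $\Sigma^*\to\Sigma^*$ with the product topology. For $\varphi\in\mathcal B$ its length is $|\varphi|:\omega\to\omega$, $|\varphi|(n)=\max\{|\varphi(a)|:|a|\le n\}$. For $l\in\omega^\omega$ let $K_l=\{\varphi\in\mathcal B: |\varphi|(n)\le l(n)\text{ for all }n\}$, and $\xi(K_l)$ denotes $\xi(K_l\cap\mathrm{dom}(\xi))$. A representation of a set $X$ is a partial surjection $\xi:\subseteq\mathcal B\to X$. Tupling of strings: for $a_1,\dots,a_k$ let $c_i$ be $a_i$ padded to length $\max_j|a_j|+1$ by appending a $1$ and then $0$s, and let $\langle a_1,\dots,a_k\rangle$ be the interleaving $c_{1,1}\dots c_{k,1}c_{1,2}\dots c_{k,2}\dots$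 of the symbols of the $c_i$. Pairing of string functions: $\langle\varphi,\psi\rangle(a)=\langle\varphi(a),\psi(a)\rangle$. The product representation of $X\times Y$ makes $\langle\varphi,\psi\rangle$ a name of $(x,y)$ iff $\varphi$ is a name of $x$ and $\psi$ a name of $y$. $\mathbb R$ is represented by: $\varphi$ is a name of $x$ iff for all $n\in\mathbb N$, $\varphi(n)\in\mathbb Z$ and $|x-\varphi(n)/(n+1)|\le 1/(n+1)$. An oracle Turing machine runs in time $T:\omega^\omega\times\omega\to\omega$ on $A\subseteq\mathcal B$ if for every oracle $\varphi\in A$ and input string $a$ it halts within $T(|\varphi|,|a|)$ steps (writing queries and reading answers costs time; the oracle writing its answer is free). A (partial) $F:\subseteq\mathcal B\to\mathcal B$ is a realizer of $f:X\to Y$ if it maps every name of $x$ to a name of $f(x)$. $f$ is computable in time $T$ on $X$ if some realizer of $f$ is computed by an oracle machine ($M^\varphi(a)=F(\varphi)(a)$) that runs in time $T$ on $\mathrm{dom}$ of the representation of $X$. A function $\nu:\omega\to\omega$ is a modulus of total boundedness of a subset $K$ of a metric space if for every $n$, $K$ can be covered by $2^{\nu(n)}$ closed balls of radius $2^{-n}$.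
   Formalization: ''Computable in time T'' for d is read as: for every l and all names φ, ψ in K_l, the machine halts on ⟨φ,ψ⟩ and a within T(l,|a|) steps, instead of T(|⟨φ,ψ⟩|,|a|); with the latter the claim fails, since |⟨φ,ψ⟩| is twice the maximum plus 2 and T need not be monotone. *)

(* Defs.v *)
From HB Require Import structures.
From mathcomp Require Import all_boot all_order all_algebra.
From mathcomp Require Import all_classical all_reals all_analysis.

Set Implicit Arguments.
Unset Strict Implicit.
Unset Printing Implicit Defensive.

Import Order.TTheory GRing.Theory Num.Theory.

Local Open Scope classical_set_scope.
Local Open Scope ring_scope.

Definition str := seq bool.
Definition baire := str -> str.

Definition len (phi : baire) (n : nat) : nat :=
  (\max_(a : n.-bseq bool) size (phi a))%N.

Definition K (l : nat -> nat) : set baire :=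
  [set phi | forall n, (len phi n <= l n)%N].

(* For size a <= m, pad m a has length m + 1. *)
Definition pad (m : nat) (a : str) : str := a ++ true :: nseq (m - size a) false.

Definition pair_str (a b : str) : str :=
  let m := maxn (size a) (size b) in
  flatten [seq [:: c.1; c.2] | c <- zip (pad m a) (pad m b)].

Definition pair_fun (phi psi : baire) : baire :=
  fun a => pair_str (phi a) (psi a).

(* Binary representations, most significant bit first and without leading
   zeros: 0 is the empty string. *)
Definition natstr (a : str) : bool := if a is b :: _ then b else true.
Definition natval (a : str) : nat := foldl (fun v (b : bool) => v.*2 + b)%N 0%N a.

(* Integers: a nonempty natural string n denotes n, and 0n denotes -n; in
   particular 0 is denoted by the string "0". *)
Definition intstr (a : str) : bool := if a is b :: a' then b || natstr a' else false.
Definition intval (a : str) : int :=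
  if a is false :: a' then - (natval a')%:Z else (natval a)%:Z.

(* A partial map from baire to X is given by its graph: xi phi x says that phi
   is a name of x. *)
Definition representation (X : Type) (xi : baire -> set X) : Prop :=
  (forall phi x y, xi phi x -> xi phi y -> x = y) /\
  (forall x, exists phi, xi phi x).

Definition dom (X : Type) (xi : baire -> set X) : set baire :=
  [set phi | exists x, xi phi x].

(* The image xi(A `&` dom xi). *)
Definition rep_image (X : Type) (xi : baire -> set X) (A : set baire) : set X :=
  [set x | exists2 phi, A phi & xi phi x].

Definition prod_rep (X Y : Type) (xi : baire -> set X) (upsilon : baire -> set Y) :
    baire -> set (X * Y) :=
  fun chi p => exists phi psi,
    [/\ chi = pair_fun phi psi, xi phi p.1 & upsilon psi p.2].

Definition real_rep (R : realType) : baire -> set R :=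
  fun phi x => forall a, natstr a ->
    intstr (phi a) /\
    `|x - (intval (phi a))%:~R / (natval a).+1%:R| <= (natval a).+1%:R^-1.

(* Oracle machines have one-way infinite tapes: a read-only input tape, a query
   tape, a read-only answer tape, an output tape (all four over {0, 1, blank},
   with None as the blank), and finitely many work tapes over an arbitrary
   finite alphabet.  In the state `query` the machine consults the oracle: in
   one step the answer tape is replaced by the value of the oracle on the
   content of the query tape, the answer head returns to the first cell, and the
   machine enters the state `answered`.  Queries are written and answers are
   read one cell per step. *)
Inductive move := Left | Stay | Right.

(* The cells beyond the stored list are blank. *)
Record tape (S : Type) := Tape { cells : seq S; pos : nat }.

Definition read (S : Type) (blk : S) (t : tape S) : S := nth blk (cells t) (pos t).

Definition write (S : Type) (blk : S) (t : tape S) (s : S) : tape S :=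
  Tape (set_nth blk (cells t) (pos t) s) (pos t).

Definition shift (S : Type) (t : tape S) (m : move) : tape S :=
  Tape (cells t)
    (match m with Left => (pos t).-1 | Stay => pos t | Right => (pos t).+1 end).

Definition write_shift (S : Type) (blk : S) (t : tape S) (sm : S * move) : tape S :=
  shift (write blk t sm.1) sm.2.

Definition tape_of_str (a : str) : tape (option bool) := Tape (map Some a) 0.

(* The bits that precede the first blank. *)
Definition str_of_tape (t : tape (option bool)) : str :=
  pmap id (take (index None (cells t)) (cells t)).

Record instr (Q S : finType) (k : nat) := Instr {
  i_state : Q;
  i_input : move;
  i_answer : move;
  i_query : option bool * move;
  i_output : option bool * move;
  i_work : {ffun 'I_k -> S * move}
}.

(* delta takes the state and the symbols under the input, answer, query, output
   and work heads. *)
Record oracle_machine := OracleMachine {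
  state : finType;
  symbol : finType;
  blank : symbol;
  nwork : nat;
  start : state;
  query : state;
  answered : state;
  halt : state;
  delta : state -> option bool -> option bool -> option bool -> option bool ->
    {ffun 'I_nwork -> symbol} -> instr state symbol nwork
}.

Record config (M : oracle_machine) := Config {
  c_state : state M;
  c_input : tape (option bool);
  c_answer : tape (option bool);
  c_query : tape (option bool);
  c_output : tape (option bool);
  c_work : {ffun 'I_(nwork M) -> tape (symbol M)}
}.

Definition init (M : oracle_machine) (a : str) : config M :=
  Config (start M) (tape_of_str a) (tape_of_str [::]) (tape_of_str [::])
    (tape_of_str [::]) [ffun => Tape [::] 0].

Definition step (M : oracle_machine) (phi : baire) (c : config M) : config M :=
  if c_state c == halt M then c
  else if c_state c == query M then
    Config (answered M) (c_input c)
      (tape_of_str (phi (str_of_tape (c_query c))))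
      (c_query c) (c_output c) (c_work c)
  else
    let i := delta (c_state c) (read None (c_input c)) (read None (c_answer c))
               (read None (c_query c)) (read None (c_output c))
               [ffun j => read (blank M) (c_work c j)] in
    Config (i_state i)
      (shift (c_input c) (i_input i))
      (shift (c_answer c) (i_answer i))
      (write_shift None (c_query c) (i_query i))
      (write_shift None (c_output c) (i_output i))
      [ffun j => write_shift (blank M) (c_work c j) (i_work i j)].

Definition run (M : oracle_machine) (phi : baire) (a : str) (n : nat) : config M :=
  iter n (step phi) (init M a).

(* The state halt is absorbing, so this says that the machine halts after at
   most n steps. *)
Definition halts_within (M : oracle_machine) (phi : baire) (a : str) (n : nat) : Prop :=
  c_state (run M phi a n) = halt M.

Definition computes (M : oracle_machine) (F : baire -> option baire) : Prop :=
  forall phi psi, F phi = Some psi -> forall a, exists2 n,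
    halts_within M phi a n & str_of_tape (c_output (run M phi a n)) = psi a.

Definition realizer (X Y : Type) (xi : baire -> set X) (upsilon : baire -> set Y)
    (f : X -> Y) (F : baire -> option baire) : Prop :=
  forall phi x, xi phi x -> exists2 psi, F phi = Some psi & upsilon psi (f x).

Definition runs_in_time (M : oracle_machine) (T : (nat -> nat) -> nat -> nat)
    (A : set baire) : Prop :=
  forall phi, A phi -> forall a, halts_within M phi a (T (len phi) (size a)).

Definition computable_in_time (X Y : Type) (xi : baire -> set X)
    (upsilon : baire -> set Y) (f : X -> Y) (T : (nat -> nat) -> nat -> nat) : Prop :=
  exists M F,
    [/\ realizer xi upsilon f F, computes M F & runs_in_time M T (dom xi)].

(* Time bounds for functions of two arguments.  The first argument of T is a
   common bound l on the lengths of the names of the two arguments, so that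
   T l bounds the time needed on names from K l.  Evaluating T at the length of
   the pair instead would not do: that length is always 2 max + 2 (see
   len_pair_fun), so without further assumptions it does not constrain T l for
   arbitrary l, and even for monotone T it constrains T (2 l + 2) rather than
   T l (see computable_in_time_pair). *)
Definition runs_in_time2 (M : oracle_machine) (T : (nat -> nat) -> nat -> nat)
    (A B : set baire) : Prop :=
  forall l phi psi, (A `&` K l) phi -> (B `&` K l) psi ->
  forall a, halts_within M (pair_fun phi psi) a (T l (size a)).

Definition computable_in_time2 (X Y Z : Type) (xi : baire -> set X)
    (upsilon : baire -> set Y) (zeta : baire -> set Z) (f : X -> Y -> Z)
    (T : (nat -> nat) -> nat -> nat) : Prop :=
  exists M F,
    [/\ realizer (prod_rep xi upsilon) zeta (fun p => f p.1 p.2) F,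
        computes M F
      & runs_in_time2 M T (dom xi) (dom upsilon)].

Lemma size_pair_str a b :
  size (pair_str a b) = (maxn (size a) (size b)).+1.*2.
Proof.
rewrite /pair_str; set m := maxn _ _.
have szp c : (size c <= m)%N -> size (pad m c) = m.+1.
  by move=> h; rewrite size_cat /= size_nseq addnS subnKC.
have -> (s : seq (bool * bool)) :
    size (flatten [seq [:: c.1; c.2] | c <- s]) = (size s).*2.
  by elim: s => //= c s ->.
by rewrite size_zip !szp ?minnn // ?leq_maxl ?leq_maxr.
Qed.

Lemma leq_len (phi : baire) n (a : n.-bseq bool) : (size (phi a) <= len phi n)%N.
Proof. exact: (leq_bigmax (F := fun a : n.-bseq bool => size (phi a))). Qed.

Lemma len_pair_fun phi psi n :
  len (pair_fun phi psi) n = (maxn (len phi n) (len psi n)).+1.*2.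
Proof.
apply/eqP; rewrite eqn_leq; apply/andP; split.
  apply/bigmax_leqP => a _; rewrite size_pair_str leq_double ltnS geq_max.
  by rewrite !leq_max !leq_len orbT.
have attained (chi : baire) : exists a : n.-bseq bool, len chi n = size (chi a).
  have c0 : (0 < #|{: n.-bseq bool}|)%N by apply/card_gt0P; exists (insub_bseq n [::]).
  by have [a ?] := bigop.eq_bigmax (fun a : n.-bseq bool => size (chi a)) c0; exists a.
have [[a ea] [b eb]] := (attained phi, attained psi).
case: (leqP (len phi n) (len psi n)) => _.
  apply: leq_trans (leq_len (pair_fun phi psi) b).
  by rewrite size_pair_str leq_double ltnS eb leq_maxr.
apply: leq_trans (leq_len (pair_fun phi psi) a).
by rewrite size_pair_str leq_double ltnS ea leq_maxl.
Qed.

Lemma halts_withinW M phi a m n :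
  (m <= n)%N -> halts_within M phi a m -> halts_within M phi a n.
Proof.
move=> /subnK <-; rewrite /halts_within /run iterD => h.
by elim: (n - m)%N => //= k IH; rewrite /step IH eqxx.
Qed.

Lemma computable_in_time_pair (X Y Z : Type) (xi : baire -> set X)
    (upsilon : baire -> set Y) (zeta : baire -> set Z) (f : X -> Y -> Z)
    (T : (nat -> nat) -> nat -> nat) :
  (forall l l' n, (forall k, l k <= l' k)%N -> (T l n <= T l' n)%N) ->
  computable_in_time (prod_rep xi upsilon) zeta (fun p => f p.1 p.2) T ->
  computable_in_time2 xi upsilon zeta f (fun l => T (fun k => (l k).+1.*2)).
Proof.
move=> Tmono [M [F [rF cF tM]]]; exists M, F; split=> //.
move=> l phi psi [[x xx] Kphi] [[y yy] Kpsi] a.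
apply: halts_withinW (tM _ _ a); last by exists (x, y), phi, psi.
by apply: Tmono => k; rewrite len_pair_fun leq_double ltnS geq_max Kphi Kpsi.
Qed.

(* At most 2 ^ nu n balls rather than exactly that many, so that the empty
   metric space is not excluded.  The closed ball is the set of points at
   distance at most r from the centre, not the closure of the open ball. *)
Definition modulus_of_total_boundedness (R : realType) (X : metricType R)
    (A : set X) (nu : nat -> nat) : Prop :=
  forall n, exists2 s : seq X, (size s <= 2 ^ nu n)%N &
    A `<=` \bigcup_(c in [set` s]) [set x | mdist c x <= 2 ^- n].

(* Main.v *)
Require Import Defs.
From mathcomp Require Import all_boot all_order all_algebra.
From mathcomp Require Import all_classical all_reals all_analysis.
From mathcomp Require Import lra.

(** Fix n, let N + 1 = 2^(n+2), let a be the binary representation of N, which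
    has length n + 2, and put t = T(l, n+2).  In t steps the machine for d
    consults its oracle at most t times and reads at most the first t symbols
    of each answer, so its run with oracle <phi, phi> on input a is determined
    by a table of t^2 symbols over {0, 1, blank}.  If phi and psi have the same
    table, then by the interleaved form of the pairing the machine cannot
    distinguish <phi, psi> from <phi, phi> either.  Hence one number
    approximates both d(x, x) = 0 and d(x, y) up to 1/(N+1), where phi and psi
    name x and y, and d(x, y) <= 2^-n.  So one ball for each of the 3^(t^2)
    tables is enough. *)

Set Implicit Arguments.
Unset Strict Implicit.
Unset Printing Implicit Defensive.

Import Order.TTheory GRing.Theory Num.Theory.

Local Open Scope classical_set_scope.

Lemma onth_flatten_zip (T : Type) (s t : seq T) j : size s = size t ->
  onth (flatten [seq [:: c.1; c.2] | c <- zip s t]) j =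
  onth (if odd j then t else s) j./2.
Proof.
elim: s t j => [|x s IH] [|y t] //= j; first by rewrite if_same !onth_default.
by case: j => [|[|j]] //= [/IH ->]; rewrite negbK; case: (odd j).
Qed.

Lemma size_pad m a : size a <= m -> size (pad m a) = m.+1.
Proof. by move=> h; rewrite size_cat /= size_nseq addnS subnKC. Qed.

(** Only the zeros after the terminating 1, hence only positions beyond [size a], depend on [m]. *)
Lemma onth_pad m a k : k <= size a -> onth (pad m a) k = onth (pad (size a) a) k.
Proof.
move=> ka; rewrite /pad !onth_cat; case: ltnP => // ak.
by rewrite (eqP ka).
Qed.

Lemma onth_pair_str a b j :
  onth (pair_str a b) j =
  onth (pad (maxn (size a) (size b)) (if odd j then b else a)) j./2.
Proof.
rewrite onth_flatten_zip; first by case: (odd j).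
by rewrite !size_pad ?leq_maxl ?leq_maxr.
Qed.

(** Let [k = j./2]. If [k] is at most both sizes, padding to the larger length changes nothing
    there. If it exceeds just one, exactly one diagonal pair has ended, contradicting the
    hypothesis. Beyond both, all pairs have ended. *)
Lemma onth_pair_str_diag a b j :
  onth (pair_str a a) j = onth (pair_str b b) j ->
  onth (pair_str a a) j = onth (pair_str a b) j.
Proof.
rewrite !onth_pair_str !maxnn !if_same; move: (j./2) => k.
have some c : k <= size c -> onth (pad (size c) c) k != None.
  move=> kc; have : k < size (pad (size c) c) by rewrite size_pad.
  by rewrite -onthTE; case: onth.
have none m c : size c <= m -> m < k -> onth (pad m c) k = None.
  by move=> cm mk; rewrite onth_default // size_pad.
case: (leqP k (size a)) => ka; case: (leqP k (size b)) => kb e.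
- by case: (odd j); rewrite onth_pad.
- by move: (some _ ka); rewrite e none.
- by move: (some _ kb); rewrite -e none.
- rewrite !none // ?gtn_max ?ka //.
  by case: (odd j); rewrite ?leq_maxl ?leq_maxr.
Qed.

Section Runs.
Variables (M : oracle_machine) (a : str).
Implicit Types (phi psi : baire) (c : config M).

(** The query tape is recorded at every step, whether or not the oracle is consulted there, so that
    queries can be indexed by time. *)
Definition nth_query phi i : str := str_of_tape (c_query (run M phi a i)).

(* After i steps the answer head is within the first i + 1 cells, so only the
   first t cells of the answer tape matter for a run of t steps. *)
Definition similar t i c c' : Prop :=
  [/\ [/\ c_state c = c_state c', c_input c = c_input c',
          c_query c = c_query c', c_output c = c_output c' &
          c_work c = c_work c'],
      pos (c_answer c) = pos (c_answer c'), pos (c_answer c) <= i &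
      forall j, j < t ->
        nth None (cells (c_answer c)) j = nth None (cells (c_answer c')) j].

Lemma similar_step t i phi psi c c' : i < t -> similar t i c c' ->
  (forall j, j < t -> onth (phi (str_of_tape (c_query c))) j =
                      onth (psi (str_of_tape (c_query c'))) j) ->
  similar t i.+1 (step phi c) (step psi c').
Proof.
case: c c' => [s ti [ca pa] tq to tw] [s' ti' [ca' pa'] tq' to' tw'] it.
case=> /= -[<- <- <- <- <-] <- pi agr ans; rewrite /step /=.
case: ifP => _; first by split; rewrite //= leqW.
case: ifP => _; first by split=> //= j jt; rewrite -!onthE ans.
rewrite /read /= -(agr pa) ?(leq_ltn_trans pi) //.
by split=> //=; case: i_answer => //=; rewrite ?leqW // (leq_trans (leq_pred _)) // leqW.
Qed.

(** Answers need to agree only where the queries already coincide, and the induction supplies that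
    coincidence. *)
Lemma similar_run t phi psi :
  (forall i, i < t -> nth_query phi i = nth_query psi i -> forall j, j < t ->
     onth (phi (nth_query phi i)) j = onth (psi (nth_query psi i)) j) ->
  forall i, i <= t -> similar t i (run M phi a i) (run M psi a i).
Proof.
move=> ans; elim=> [|i IH] it; first by split.
have sim := IH (ltnW it); rewrite /run !iterS; apply: similar_step => //.
by apply: ans => //; case: sim => -[_ _ eq_query _ _] _ _ _; rewrite /nth_query eq_query.
Qed.

Lemma run_halted phi m n : halts_within M phi a m -> m <= n ->
  run M phi a n = run M phi a m.
Proof.
move=> h /subnK <-; rewrite /run iterD; elim: (n - m) => //= k ->.
by rewrite /step; move: h; rewrite /halts_within /run => ->; rewrite eqxx.
Qed.

Lemma run_halts_unique phi m n : halts_within M phi a m -> halts_within M phi a n ->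
  run M phi a m = run M phi a n.
Proof.
by case: (leqP m n) => [mn hm _|/ltnW nm _ hn]; [rewrite (run_halted hm)|rewrite (run_halted hn)].
Qed.

Definition transcript t phi : {ffun 'I_t -> t.-tuple (option bool)} :=
  let chi := pair_fun phi phi in
  [ffun i : 'I_t => [tuple onth (chi (nth_query chi i)) j | j < t]].

Lemma transcript_similar t phi psi : transcript t phi = transcript t psi ->
  similar t t (run M (pair_fun phi phi) a t) (run M (pair_fun phi psi) a t).
Proof.
set pp := pair_fun phi phi; set qq := pair_fun psi psi => etr.
have etr_nth i j : i < t -> j < t ->
    onth (pp (nth_query pp i)) j = onth (qq (nth_query qq i)) j.
  move=> it jt; move/ffunP/(_ (Ordinal it)): etr; rewrite !ffunE.
  by move/(congr1 (fun s => tnth s (Ordinal jt))); rewrite !tnth_mktuple.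
(* The two diagonal runs are compared first: they make the same queries, so at each of them both
   diagonal answers are known to agree, as [onth_pair_str_diag] requires. *)
have sim i : i <= t -> similar t i (run M pp a i) (run M qq a i).
  by apply: similar_run => k kt _ j jt; exact: etr_nth.
apply: similar_run => // i it <- j jt; apply: onth_pair_str_diag.
rewrite -/(pp _) -/(qq _) etr_nth //.
by case: (sim i (ltnW it)) => -[_ _ eq_query _ _] _ _ _; rewrite /nth_query eq_query.
Qed.

(** There are [3 ^ (t ^ 2)] transcripts, and 3 is at most [2 ^ 2]. *)
Lemma card_transcript t :
  #|{ffun 'I_t -> t.-tuple (option bool)}| <= 2 ^ (2 * t ^ 2).
Proof.
rewrite card_ffun card_tuple card_option card_bool card_ord -expnM mulnn expnM.
by case: t => [|t] //; rewrite leq_exp2r.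
Qed.

End Runs.

(** One witness chosen for each [w] that occurs; these become the centres of the balls. *)
Lemma finite_transversal (X : choiceType) (W : finType) (P : X -> W -> Prop) :
  exists2 s : seq X, size s <= #|W| &
    forall x w, P x w -> exists2 c, c \in s & P c w.
Proof.
pose rep w := if pselect (exists x, P x w) is left e then Some (projT1 (cid e)) else None.
exists (pmap rep (enum W)); first by rewrite size_pmap cardE count_size.
move=> x w Pxw; case e: (rep w) => [c|]; last first.
  by move: e; rewrite /rep; case: pselect => // -[]; exists x.
exists c; first by rewrite mem_pmap -e map_f ?mem_enum.
by move: e; rewrite /rep; case: pselect => // ? [<-]; case: cid.
Qed.

Lemma natval_ones n : (natval (nseq n true)).+1 = 2 ^ n.
Proof.
suff gen v : (foldl (fun v (b : bool) => v.*2 + b) v (nseq n true)).+1 = v.+1 * 2 ^ n.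
  by rewrite /natval gen mul1n.
elim: n v => [|n IH] v /=; first by rewrite muln1.
by rewrite IH expnS mulnA; congr (_ * _); rewrite muln2 doubleS addn1.
Qed.

Local Open Scope ring_scope.

Lemma common_approximation (R : realType) (phi psi : baire) (x y : R) a :
  natstr a -> real_rep phi x -> real_rep psi y -> phi a = psi a ->
  `|x - y| <= 2 / (natval a).+1%:R.
Proof.
move=> na /(_ a na)[_ hx] /(_ a na)[_ hy] e; rewrite -{}e in hy.
rewrite -(subrKA ((intval (phi a))%:~R / (natval a).+1%:R)) mulr2n mulrDl mul1r.
by rewrite (le_trans (ler_normD _ _)) // lerD // distrC.
Qed.

Theorem mainTheorem1 (R : realType) (X : metricType R) (xi : baire -> set X)
    (T : (nat -> nat) -> nat -> nat)
    (hxi : representation xi)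
    (hd : computable_in_time2 xi xi (@real_rep R) (fun x y : X => mdist x y) T) :
  exists C : nat, forall l : nat -> nat,
    modulus_of_total_boundedness (rep_image xi (K l))
      (fun n : nat => (C * T l (n + 2) ^ 2 + C)%N).
Proof.
(* The factor 2 is the one in the exponent of [card_transcript]. *)
case: hd => M [F [real_F comp_F time_M]]; exists 2%N => l n.
pose a := nseq (n + 2) true; pose t := T l (n + 2)%N.
pose P x w := exists phi, [/\ xi phi x, K l phi & transcript M a t phi = w].
have [s size_s cover_s] := finite_transversal P; exists s.
  rewrite (leq_trans size_s) // (leq_trans (card_transcript t)) //.
  by rewrite leq_pexp2l // leq_addr.
move=> x [phi Kphi xix].
have [|c cs [psi [xic Kpsi etr]]] := cover_s x (transcript M a t phi); first by exists phi.
exists c => //=.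
(* Used with [chi] equal to [psi] and to [phi]. The halting time given by [comp_F] may differ from
   [t], but the halted configurations coincide. *)
have output chi z : xi chi z -> K l chi -> exists2 u,
    real_rep u (mdist c z) & str_of_tape (c_output (run M (pair_fun psi chi) a t)) = u a.
  move=> xiz Kchi.
  have [|u Fu repu] := real_F (pair_fun psi chi) (c, z); first by exists psi, chi.
  exists u => //; have [m hm <-] := comp_F _ _ Fu a.
  suff ht : halts_within M (pair_fun psi chi) a t by rewrite (run_halts_unique ht hm).
  have := time_M l psi chi _ _ a; rewrite size_nseq; apply; split=> //.
    by exists c.
  by exists z.
have [u repu eu] := output _ _ xic Kpsi.
have [v repv ev] := output _ _ xix Kphi.
have [[_ _ _ eout _] _ _ _] := transcript_similar etr.
have euv : v a = u a by rewrite -eu -ev eout.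
have na : natstr a by rewrite /a addn2.
have := common_approximation na repv repu euv.
(* Two errors of [2 ^- (n + 2)] add up to at most [2 ^- n]. *)
rewrite mdistxx subr0 natval_ones ger0_norm ?mdist_ge0 // => /le_trans; apply.
by rewrite natrX exprD invfM mulrCA ler_piMr ?invr_ge0 ?exprn_ge0 //; lra.
Qed.
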